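(* Let $K$ be a complete non-Archimedean valued field with nontrivial valuation and residue field $\widetilde{K}$, let $G$ be an arbitrary group, and let $\mathcal B=c_0(G,K)$. Let $\mathbf R=\{U_g : g\in G\}$ and $\mathbf L=\{V_g : g\in G\}$ be the sets of operators on $\mathcal B$ given by the right and left regular representations, $U_g[x_a;a\in G]=[x_{ag};a\in G]$ and $V_g[x_a;a\in G]=[x_{g^{-1}a};a\in G]$. Let $\mathbf M$ and $\mathbf N$ be the closed linear spans of $\mathbf R$ and $\mathbf L$, respectively, in the strong operator topology on $L(\mathcal B)$. Then: (i) $\mathbf M$ coincides with the closed linear span of $\mathbf R$ in the uniform operator topology. In addition, $\mathbf M=\mathbf L'$. Similarly, $\mathbf N=\mathbf R'$, and also $\mathbf M=\mathbf R''=\mathbf M''$ and $\mathbf N=\mathbf L''=\mathbf N''$. (ii) The reduction $\widetilde{\mathbf M}$ is isomorphic (as a $\widetilde{K}$-algebra) to the group algebra $\widetilde{K}[G]$. (iii) $\mathbf M$ is a factor (that is, its center consists of scalar operators) if and only if for each $a\in G$ with $a\neq 1$ the set $C_a=\{c^{-1}ac : c\in G\}$ of elements conjugate to $a$ is infinite.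
   Context: $c_0(G,K)$ is the Banach space over $K$ of families $x=[x_a;a\in G]$, $x_a\in K$, which, if $G$ is infinite, tend to $0$ along the filter of complements of finite subsets of $G$; the norm is $\|x\|=\sup_a|x_a|$. $L(\mathcal B)$ is the algebra of all bounded $K$-linear operators on $\mathcal B$ with the operator norm. The uniform operator topology is the operator norm topology; the strong operator topology is defined by the seminorms $A\mapsto\|Ax\|$, $x\in\mathcal B$. For a set $\mathbf P\subset L(\mathcal B)$, the commutant is $\mathbf P'=\{A\in L(\mathcal B): AP=PA \text{ for all } P\in\mathbf P\}$, and $\mathbf P''=(\mathbf P')'$. For a unital algebra $\mathfrak A\subset L(\mathcal B)$, let $\mathfrak A_1$ be the set of its elements of operator norm $\le 1$ (an algebra over the ring of integers $O$ of $K$) and $\mathfrak A_0$ the ideal of $\mathfrak A_1$ consisting of elements of norm $<1$; the reduction of $\mathfrak A$ is $\widetilde{\mathfrak A}=\mathfrak A_1/\mathfrak A_0$, regarded as a unital $\widetilde{K}$-algebra. *)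

(* Defs.v *)
From HB Require Import structures.
From mathcomp Require Import all_boot all_order all_algebra.
From mathcomp Require Import all_classical all_reals topology.

Set Implicit Arguments.
Unset Strict Implicit.
Unset Printing Implicit Defensive.

Import Order.TTheory GRing.Theory Num.Theory.

Local Open Scope classical_set_scope.
Local Open Scope quotient_scope.
Local Open Scope ring_scope.

(* Valuations are written multiplicatively, with values in the reals.  The
   library's normed spaces require |n x| = n |x|, which excludes ultrametric
   norms, so the norms below are separate functions. *)
HB.mixin Record Field_isCompleteNonArch (R : realType) K & GRing.Field K := {
  absv : K -> R;
  absv_ge0 : forall x, 0 <= absv x;
  absv_eq0 : forall x, (absv x == 0) = (x == 0);
  absvM : forall x y, absv (x * y) = absv x * absv y;
  absvD : forall x y, absv (x + y) <= Num.max (absv x) (absv y);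
  absv_nontrivial : exists2 x, x != 0 & absv x != 1;
  absv_complete : forall u : nat -> K,
    (forall e : R, 0 < e -> exists N : nat, forall m n : nat,
       (N <= m)%N -> (N <= n)%N -> absv (u m - u n) < e) ->
    exists l : K, forall e : R, 0 < e -> exists N : nat, forall n : nat,
      (N <= n)%N -> absv (u n - l) < e
}.

#[short(type="completeNonArchFieldType")]
HB.structure Definition CompleteNonArchField (R : realType) :=
  { K of GRing.Field K & Field_isCompleteNonArch R K }.

Section AbsvTheory.
Context (R : realType) (K : completeNonArchFieldType R).
Implicit Types x y : K.

Lemma absv0 : absv (0 : K) = 0 :> R.
Proof. by apply/eqP; rewrite absv_eq0. Qed.

Lemma absv1 : absv (1 : K) = 1 :> R.
Proof.
have n0 : absv (1 : K) != 0 :> R by rewrite absv_eq0 oner_eq0.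
by apply: (mulfI n0); rewrite mulr1 -absvM mulr1.
Qed.

Lemma absvN1 : absv (-1 : K) = 1 :> R.
Proof.
have /eqP : absv (-1 : K) ^+ 2 = 1 :> R by rewrite expr2 -absvM mulrNN mulr1 absv1.
rewrite sqrf_eq1 => /orP[/eqP//|/eqP e].
by have := @absv_ge0 R K (-1); rewrite e ler0N1.
Qed.

Lemma absvN x : absv (- x) = absv x :> R.
Proof. by rewrite -mulN1r absvM absvN1 mul1r. Qed.

Lemma absvB x y : absv (x - y) <= Num.max (absv x) (absv y) :> R.
Proof. by rewrite -[absv y]absvN; exact: absvD. Qed.

Lemma absvD_le x y (c : R) : absv x <= c -> absv y <= c -> absv (x + y) <= c.
Proof.
by move=> hx hy; apply: (le_trans (absvD _ _)); rewrite ge_max hx hy.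
Qed.

Lemma absvD_lt x y (c : R) : absv x < c -> absv y < c -> absv (x + y) < c.
Proof.
by move=> hx hy; apply: (le_lt_trans (absvD _ _)); rewrite gt_max hx hy.
Qed.

End AbsvTheory.

Section ResidueField.
Context (R : realType) (K : completeNonArchFieldType R).

Definition integers_pred : {pred K} := fun x => absv x <= 1 :> R.

Fact integers_subring : subring_closed integers_pred.
Proof.
split=> [|x y hx hy|x y hx hy]; rewrite unfold_in.
- by rewrite absv1.
- by apply: absvD_le; rewrite ?absvN.
- by rewrite absvM mulr_ile1 ?absv_ge0.
Qed.

HB.instance Definition _ :=
  GRing.isSubringClosed.Build K integers_pred integers_subring.

Record integers := Integer { integer_val :> K; _ : integer_val \in integers_pred }.

HB.instance Definition _ := [isSub for integer_val].
HB.instance Definition _ := [Choice of integers by <:].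
HB.instance Definition _ := [SubChoice_isSubComNzRing of integers by <:].

Definition maximal_ideal : {pred integers} := fun x => absv (val x) < 1 :> R.

Fact maximal_ideal_closed : idealr_closed maximal_ideal.
Proof.
split=> [||a u v hu hv]; rewrite unfold_in /=.
- by rewrite absv0 ltr01.
- by rewrite absv1 ltxx.
- apply: absvD_lt => //; rewrite absvM; apply: le_lt_trans hu.
  by rewrite ler_piMl ?absv_ge0//; exact: (valP a).
Qed.

HB.instance Definition _ :=
  isIdealr.Build integers maximal_ideal maximal_ideal_closed.

Fact ideal_quot_inv (x : {ideal_quot maximal_ideal}) :
  exists y, x != 0 -> y * x = 1.
Proof.
rewrite -[x]reprK; set r := repr x.
have [hx|hx] := boolP (r \in maximal_ideal).
  by exists 0; rewrite piE Quotient.equivE subr0 hx.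
have x1 : absv (val r) = 1 :> R.
  apply/eqP; rewrite eq_le; rewrite unfold_in /= -leNgt in hx.
  by rewrite hx andbT; exact: (valP r).
have x0 : val r != 0 by rewrite -(@absv_eq0 R) x1 oner_neq0.
have hy : (val r)^-1 \in integers_pred.
  by rewrite unfold_in -[leLHS]mulr1 -x1 -absvM mulVf // absv1 x1.
exists (\pi_{ideal_quot maximal_ideal} (Integer hy)) => _.
apply/eqP; rewrite piE Quotient.equivE.
by rewrite (_ : _ * r = 1) ?subrr ?rpred0 //; apply: val_inj; rewrite /= mulVf.
Qed.

Definition residue_field := {ideal_quot maximal_ideal}.

HB.instance Definition _ := EqQuotient.on residue_field.
HB.instance Definition _ := GRing.ComNzRing.on residue_field.

Definition residue_inv (x : residue_field) : residue_field :=
  if x == 0 then 0 else projT1 (cid (ideal_quot_inv x)).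

Fact residue_mulVf (x : residue_field) : x != 0 -> residue_inv x * x = 1.
Proof.
by move=> x0; rewrite /residue_inv ifN //; case: cid => y /= ->.
Qed.

Fact residue_invr0 : residue_inv 0 = 0.
Proof. by rewrite /residue_inv ifT. Qed.

HB.instance Definition _ :=
  GRing.ComNzRing_isField.Build residue_field residue_mulVf residue_invr0.

End ResidueField.
Arguments residue_field {R} K.

Section C0.
Context (R : realType) (G : groupType) (K : completeNonArchFieldType R).

(* The families tending to 0 along the complements of finite sets; no condition
   when G is finite. *)
Definition vanishing : {pred G -> K^o} := fun x =>
  `[< forall e : R, 0 < e -> finite_set [set a | e <= absv (x a)] >].

Fact vanishing_submod : submod_closed vanishing.
Proof.
split=> [|k x y hx hy].
  apply/asboolP => e e0; rewrite (_ : [set _ | _] = set0) //.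
  by apply/seteqP; split=> a //=; rewrite absv0 leNgt e0.
apply/asboolP => e e0; move/asboolP in hx; move/asboolP in hy.
have [->|k0] := eqVneq k 0; first by rewrite scale0r add0r; exact: hy.
have kp : 0 < absv k :> R by rewrite lt_neqAle absv_ge0 eq_sym absv_eq0 k0.
have fU : finite_set ([set a | e / absv k <= absv (x a)] `|`
                      [set a | e <= absv (y a)]).
  by rewrite finite_setU; split; [apply: hx; rewrite divr_gt0|exact: hy].
apply: sub_finite_set fU => a /= hea; apply: contrapT => /not_orP[].
move=> /negP; rewrite -ltNge ltr_pdivlMr // => h1 /negP; rewrite -ltNge => h2.
move: hea; rewrite leNgt => /negP; apply; apply: absvD_lt => //.
by rewrite absvM mulrC.
Qed.

HB.instance Definition _ :=
  GRing.isSubmodClosed.Build K (G -> K^o) vanishing vanishing_submod.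

Record c0 := C0 { c0_val :> G -> K^o; _ : c0_val \in vanishing }.

HB.instance Definition _ := [isSub for c0_val].
HB.instance Definition _ := [Choice of c0 by <:].
HB.instance Definition _ := [SubChoice_isSubLmodule of c0 by <:].

Definition c0_norm (x : c0) : R := sup (range (fun a : G => absv (x a))).

Implicit Types x y : c0.

Lemma c0P x y : (forall a, x a = y a) <-> x = y.
Proof. by split=> [h|->//]; apply: val_inj; apply: funext. Qed.

Lemma c0DE x y a : (x + y) a = x a + y a. Proof. by []. Qed.
Lemma c0NE x a : (- x) a = - x a. Proof. by []. Qed.
Lemma c0ZE k x a : (k *: x) a = k * x a. Proof. by []. Qed.

Lemma has_sup_c0 x : has_sup (range (fun a : G => absv (x a) : R)).
Proof.
split; first by exists (absv (x 1%g)), 1%g.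
have /asboolP/(_ 1 ltr01)/finite_seqP[s hs] := valP x.
exists (\big[Num.max/1]_(a <- s) absv (x a)) => _ [a _ <-].
have [ha|ha] := leP 1 (absv (x a) : R).
  apply: (@Order.TotalTheory.le_bigmax_seq _ _ _ s 1 a xpredT (fun a => absv (x a))) => //.
  by have : [set` s] a by rewrite -hs.
apply: (le_trans (ltW ha)); exact: bigmax_ge_id.
Qed.

Lemma absv_le_c0_norm x a : absv (x a) <= c0_norm x.
Proof.
by apply: (sup_upper_bound (has_sup_c0 x)); exists a.
Qed.

Lemma c0_norm_le x (c : R) : (forall a, absv (x a) <= c) -> c0_norm x <= c.
Proof.
move=> h; apply: ge_sup; first by exists (absv (x 1%g)), 1%g.
by move=> _ [a _ <-].
Qed.

Lemma c0_norm_ge0 x : 0 <= c0_norm x.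
Proof. exact: le_trans (absv_ge0 _) (absv_le_c0_norm x 1%g). Qed.

Lemma c0_norm_eq0 x : (c0_norm x == 0) = (x == 0).
Proof.
apply/eqP/eqP => [x0|->].
  apply/c0P => a; apply/eqP; rewrite -(@absv_eq0 R) eq_le absv_ge0 andbT -x0.
  exact: absv_le_c0_norm.
by apply/le_anti; rewrite c0_norm_ge0 andbT c0_norm_le // => a; rewrite absv0.
Qed.

Lemma c0_normZ k x : c0_norm (k *: x) = absv k * c0_norm x.
Proof.
have le k' x' : c0_norm (k' *: x') <= absv k' * c0_norm x'.
  apply: c0_norm_le => a.
  by rewrite c0ZE absvM ler_wpM2l ?absv_ge0 ?absv_le_c0_norm.
apply/le_anti; rewrite le /=.
have [->|k0] := eqVneq k 0; first by rewrite absv0 mul0r c0_norm_ge0.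
have kp : 0 < absv k :> R by rewrite lt_neqAle absv_ge0 eq_sym absv_eq0 k0.
rewrite -{1}(scalerK k0 x).
apply: (le_trans (ler_wpM2l (absv_ge0 _) (le _ _))).
by rewrite mulrA -absvM mulfV // absv1 mul1r.
Qed.

Lemma c0_normD_le x y (c : R) :
  c0_norm x <= c -> c0_norm y <= c -> c0_norm (x + y) <= c.
Proof.
move=> hx hy; apply: c0_norm_le => a; rewrite c0DE; apply: absvD_le.
  exact: le_trans (absv_le_c0_norm _ _) hx.
exact: le_trans (absv_le_c0_norm _ _) hy.
Qed.

Lemma c0_normD_lt x y (c : R) :
  c0_norm x < c -> c0_norm y < c -> c0_norm (x + y) < c.
Proof.
move=> hx hy; apply: (@le_lt_trans _ _ (Num.max (c0_norm x) (c0_norm y))).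
  by apply: c0_normD_le; rewrite le_max lexx ?orbT.
by rewrite gt_max hx hy.
Qed.

Lemma c0_normD x y : c0_norm (x + y) <= Num.max (c0_norm x) (c0_norm y).
Proof. by apply: c0_normD_le; rewrite le_max lexx ?orbT. Qed.

Lemma c0_normN x : c0_norm (- x) = c0_norm x.
Proof. by rewrite -scaleN1r c0_normZ absvN1 mul1r. Qed.

End C0.
Arguments c0 {R} G K.
Arguments vanishing {R} G K.

Section BoundedOperators.
Context (R : realType) (G : groupType) (K : completeNonArchFieldType R).
Local Notation B := (c0 G K).

Definition bounded_linear : {pred B -> B} := fun f =>
  `[< linear f /\ exists C : R, forall x, c0_norm (f x) <= C * c0_norm x >].

Fact bounded_linear_submod : submod_closed bounded_linear.
Proof.
split=> [|k f g /asboolP[fl [C fC]] /asboolP[gl [D gD]]]; apply/asboolP; split.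
- by move=> a x y; rewrite scaler0 addr0.
- exists 0 => x; rewrite mul0r; apply: c0_norm_le => a; by rewrite absv0.
- move=> a x y; rewrite !fctE fl gl !scalerDr !scalerA mulrC.
  by rewrite addrACA.
- exists (Num.max (absv k * C) D) => x; rewrite !fctE.
  have n0 := c0_norm_ge0 x; apply: c0_normD_le.
    rewrite c0_normZ; apply: (@le_trans _ _ (absv k * (C * c0_norm x))).
      by rewrite ler_wpM2l ?absv_ge0.
    by rewrite mulrA ler_wpM2r // le_max lexx.
  by apply: (le_trans (gD x)); rewrite ler_wpM2r // le_max lexx orbT.
Qed.

HB.instance Definition _ :=
  GRing.isSubmodClosed.Build K (B -> B) bounded_linear bounded_linear_submod.

Record bounded_op :=
  BoundedOp { bounded_op_val :> B -> B; _ : bounded_op_val \in bounded_linear }.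

HB.instance Definition _ := [isSub for bounded_op_val].
HB.instance Definition _ := [Choice of bounded_op by <:].
HB.instance Definition _ := [SubChoice_isSubLmodule of bounded_op by <:].

Implicit Types S T : bounded_op.

Lemma bounded_opP S T : (forall x, S x = T x) <-> S = T.
Proof. by split=> [h|->//]; apply: val_inj; apply: funext. Qed.

Lemma bounded_opDE S T x : (S + T) x = S x + T x. Proof. by []. Qed.
Lemma bounded_opNE S x : (- S) x = - S x. Proof. by []. Qed.
Lemma bounded_opZE k S x : (k *: S) x = k *: S x. Proof. by []. Qed.

Lemma bounded_op_linear T : linear T.
Proof. by case: T => f /= /asboolP[]. Qed.

HB.instance Definition _ T :=
  GRing.isLinear.Build K B B *:%R (bounded_op_val T) (bounded_op_linear T).

Lemma bounded_op_bound T : exists2 C : R,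
  0 <= C & forall x, c0_norm (T x) <= C * c0_norm x.
Proof.
case: T => f /= /asboolP[_ [C hC]]; exists (Num.max 0 C).
  by rewrite le_max lexx.
move=> x; apply: (le_trans (hC x)).
by rewrite ler_wpM2r ?c0_norm_ge0 // le_max lexx orbT.
Qed.

Fact op_one_subproof : @id B \in bounded_linear.
Proof. by apply/asboolP; split=> //; exists 1 => x; rewrite mul1r. Qed.
Definition op_one := BoundedOp op_one_subproof.

Fact op_comp_subproof S T : S \o T \in bounded_linear.
Proof.
apply/asboolP; split=> [a x y|]; first by rewrite /= !linearP.
have [C C0 hC] := bounded_op_bound S; have [D D0 hD] := bounded_op_bound T.
exists (C * D) => x; apply: (le_trans (hC _)).
by rewrite -mulrA ler_wpM2l.
Qed.
Definition op_comp S T := BoundedOp (op_comp_subproof S T).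

Fact c0_unit_subproof : (fun a : G => (a == 1%g)%:R : K^o) \in vanishing G K.
Proof.
apply/asboolP => e e0; apply: (@sub_finite_set _ _ [set 1%g]) => // a /=.
by case: eqP => //= _; rewrite absv0 leNgt e0.
Qed.

Fact op_one_neq0 : op_one != 0.
Proof.
apply/eqP => /bounded_opP/(_ (C0 c0_unit_subproof))/c0P/(_ 1%g) /=.
by rewrite eqxx => /eqP; rewrite oner_eq0.
Qed.

Fact op_compA : associative op_comp.
Proof. by move=> S T U; apply/bounded_opP. Qed.
Fact op_comp1l : left_id op_one op_comp.
Proof. by move=> S; apply/bounded_opP. Qed.
Fact op_comp1r : right_id op_one op_comp.
Proof. by move=> S; apply/bounded_opP. Qed.
Fact op_compDl : left_distributive op_comp +%R.
Proof. by move=> S T U; apply/bounded_opP. Qed.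
Fact op_compDr : right_distributive op_comp +%R.
Proof. by move=> S T U; apply/bounded_opP => x /=; rewrite linearD. Qed.

HB.instance Definition _ := GRing.Zmodule_isNzRing.Build bounded_op
  op_compA op_comp1l op_comp1r op_compDl op_compDr op_one_neq0.

Fact op_scaleAl (k : K) S T : k *: (S * T) = (k *: S) * T.
Proof. by apply/bounded_opP. Qed.

HB.instance Definition _ :=
  GRing.Lmodule_isLalgebra.Build K bounded_op op_scaleAl.

Fact op_scaleAr (k : K) S T : k *: (S * T) = S * (k *: T).
Proof. by apply/bounded_opP => x; rewrite /= linearZ. Qed.

HB.instance Definition _ :=
  GRing.Lalgebra_isAlgebra.Build K bounded_op op_scaleAr.

Lemma bounded_op1E x : (1 : bounded_op) x = x. Proof. by []. Qed.
Lemma bounded_opME S T x : (S * T) x = S (T x). Proof. by []. Qed.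

Definition op_norm T : R :=
  sup [set c0_norm (T x) / c0_norm x | x in [set x | x != 0]].

Lemma op_norm_has_sup T :
  has_sup [set c0_norm (T x) / c0_norm x | x in [set x | x != 0]].
Proof.
split.
  exists (c0_norm (T (C0 c0_unit_subproof)) / c0_norm (C0 c0_unit_subproof)).
  exists (C0 c0_unit_subproof) => //=.
  apply/eqP => /c0P/(_ 1%g) /=.
  by rewrite eqxx => /eqP; rewrite oner_eq0.
have [C C0 hC] := bounded_op_bound T; exists C => _ [x /= x0 <-].
rewrite ler_pdivrMr //.
by rewrite lt_neqAle c0_norm_ge0 eq_sym c0_norm_eq0 x0.
Qed.

Lemma le_op_norm T x : c0_norm (T x) <= op_norm T * c0_norm x.
Proof.
have [->|x0] := eqVneq x 0.
  by rewrite linear0 (_ : c0_norm 0 = 0) ?mulr0//; apply/eqP; rewrite c0_norm_eq0.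
rewrite -ler_pdivrMr; last by rewrite lt_neqAle c0_norm_ge0 eq_sym c0_norm_eq0 x0.
by apply: (sup_upper_bound (op_norm_has_sup T)); exists x.
Qed.

Lemma op_norm_le T (C : R) :
  (forall x, c0_norm (T x) <= C * c0_norm x) -> op_norm T <= C.
Proof.
move=> h; apply: ge_sup; first by case: (op_norm_has_sup T).
move=> _ [x /= x0 <-]; rewrite ler_pdivrMr //.
by rewrite lt_neqAle c0_norm_ge0 eq_sym c0_norm_eq0 x0.
Qed.

Lemma op_norm_ge0 T : 0 <= op_norm T.
Proof.
have [[r hr] ub] := op_norm_has_sup T.
apply: (le_trans _ (sup_upper_bound (op_norm_has_sup T) hr)).
by case: hr => x _ <-; rewrite divr_ge0 ?c0_norm_ge0.
Qed.

Lemma op_normD_le S T (C : R) :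
  op_norm S <= C -> op_norm T <= C -> op_norm (S + T) <= C.
Proof.
move=> hS hT; apply: op_norm_le => x; apply: c0_normD_le.
  by apply: (le_trans (le_op_norm _ _)); rewrite ler_wpM2r ?c0_norm_ge0.
by apply: (le_trans (le_op_norm _ _)); rewrite ler_wpM2r ?c0_norm_ge0.
Qed.

Lemma op_normD_lt S T (C : R) :
  op_norm S < C -> op_norm T < C -> op_norm (S + T) < C.
Proof.
move=> hS hT; apply: (@le_lt_trans _ _ (Num.max (op_norm S) (op_norm T))).
  by apply: op_normD_le; rewrite le_max lexx ?orbT.
by rewrite gt_max hS hT.
Qed.

Lemma op_normN T : op_norm (- T) = op_norm T.
Proof.
rewrite /op_norm; congr sup; apply/seteqP.
by split=> _ [x x0 <-]; exists x => //=; rewrite c0_normN.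
Qed.

Lemma op_norm0 : op_norm 0 = 0.
Proof.
apply/le_anti; rewrite op_norm_ge0 andbT; apply: op_norm_le => x.
by rewrite mul0r; apply: c0_norm_le => a; rewrite absv0.
Qed.

Lemma op_norm1 : op_norm 1 = 1.
Proof.
apply/le_anti/andP; split.
  by apply: op_norm_le => x; rewrite mul1r.
have := le_op_norm 1 (C0 c0_unit_subproof).
rewrite bounded_op1E -[leLHS]mul1r ler_pM2r //.
rewrite lt_neqAle c0_norm_ge0 eq_sym c0_norm_eq0 andbT.
apply/eqP => /c0P/(_ 1%g) /=.
by rewrite eqxx => /eqP; rewrite oner_eq0.
Qed.

Lemma op_normM S T : op_norm (S * T) <= op_norm S * op_norm T.
Proof.
apply: op_norm_le => x; rewrite bounded_opME.
apply: (le_trans (le_op_norm _ _)).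
by rewrite -mulrA ler_wpM2l ?op_norm_ge0 ?le_op_norm.
Qed.

Lemma op_normZ_le (k : K) T : op_norm (k *: T) <= absv k * op_norm T.
Proof.
apply: op_norm_le => x; rewrite bounded_opZE c0_normZ -mulrA.
by rewrite ler_wpM2l ?absv_ge0 ?le_op_norm.
Qed.

End BoundedOperators.
Arguments bounded_op {R} G K.
Arguments bounded_linear {R} G K.

Definition linear_span (K : pzRingType) (V : lmodType K) (X : set V) : set V :=
  [set v | exists2 s : seq (K * V),
     (forall p, p \in s -> X p.2) & v = \sum_(p <- s) p.1 *: p.2].

Lemma sub_linear_span (K : pzRingType) (V : lmodType K) (X : set V) :
  X `<=` linear_span X.
Proof.
move=> v Xv; exists [:: (1, v)] => [p|]; first by rewrite inE => /eqP ->.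
by rewrite big_seq1 scale1r.
Qed.

Lemma linear_span_linear (K : pzRingType) (V : lmodType K) (X : set V) k u v :
  linear_span X u -> linear_span X v -> linear_span X (k *: u + v).
Proof.
move=> [s sX ->] [t tX ->]; exists ([seq (k * p.1, p.2) | p <- s] ++ t).
  by move=> p; rewrite mem_cat => /orP[/mapP[q /sX Xq ->]//|/tX].
rewrite big_cat big_map scaler_sumr; congr (_ + _).
by apply: eq_bigr => p _; rewrite scalerA.
Qed.

Lemma linear_spanM (K : comNzRingType) (A : algType K) (X : set A) u v :
  (forall a b, X a -> X b -> X (a * b)) ->
  linear_span X u -> linear_span X v -> linear_span X (u * v).
Proof.
move=> XM [s sX ->] [t tX ->].
exists [seq (p.1 * q.1, p.2 * q.2) | p <- s, q <- t].
  by move=> p /allpairsP[[q r] /= [/sX Xq /tX Xr ->]]; exact: XM.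
rewrite big_distrlr big_allpairs_dep /=; apply: eq_bigr => p _.
by apply: eq_bigr => q _; rewrite -scalerAl -scalerAr scalerA.
Qed.

Definition commutant (A : pzRingType) (X : set A) : set A :=
  [set a | forall x, X x -> a * x = x * a].

Definition is_factor (K : pzRingType) (A : lalgType K) (X : set A) :=
  X `&` commutant X = range (fun k : K => k%:A).

Section OperatorTopologies.
Context (R : realType) (G : groupType) (K : completeNonArchFieldType R).
Local Notation B := (c0 G K).
Local Notation L := (bounded_op G K).

(* Two copies of the type of bounded operators, one for each topology. *)
Definition strong_operator : Type := L.
HB.instance Definition _ := Choice.on strong_operator.

Definition strong_nbhs (T : strong_operator) : set_system strong_operator :=
  [set U | exists (s : seq B) (e : R), 0 < e /\
    forall S : L, {in s, forall x, c0_norm ((S - T : L) x) < e} -> U S].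

HB.instance Definition _ := hasNbhs.Build strong_operator strong_nbhs.

Fact strong_nbhs_filter (T : strong_operator) : ProperFilter (nbhs T).
Proof.
split; last split.
- move=> [s [e [e0 /(_ T)]]]; apply => x _.
  by rewrite subrr; apply: le_lt_trans e0; apply: c0_norm_le => a; rewrite absv0.
- by exists [::], 1; split.
- move=> U V [s [e [e0 hU]]] [t [d [d0 hV]]].
  exists (s ++ t), (Num.min e d); split; first by rewrite lt_min e0 d0.
  move=> S hS; split.
    apply: hU => x xs; have := hS x; rewrite mem_cat xs /= => /(_ isT).
    by rewrite lt_min => /andP[].
  apply: hV => x xt; have := hS x; rewrite mem_cat xt orbT => /(_ isT).
  by rewrite lt_min => /andP[].
- move=> U V UV [s [e [e0 hU]]]; exists s, e; split=> // S hS.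
  by apply: UV; exact: hU.
Qed.

Fact strong_nbhs_singleton (T : strong_operator) (U : set strong_operator) :
  nbhs T U -> U T.
Proof.
move=> [s [e [e0 /(_ T)]]]; apply => x _.
by rewrite subrr; apply: le_lt_trans e0; apply: c0_norm_le => a; rewrite absv0.
Qed.

Fact strong_nbhs_nbhs (T : strong_operator) (U : set strong_operator) :
  nbhs T U -> nbhs T (nbhs^~ U).
Proof.
move=> [s [e [e0 hU]]]; exists s, e; split=> // S hS.
exists s, e; split=> // S' hS'; apply: hU => x xs.
rewrite -(subrKA (S : L)) bounded_opDE.
by apply: c0_normD_lt; [exact: hS'|exact: hS].
Qed.

HB.instance Definition _ := Nbhs_isNbhsTopological.Build strong_operator
  strong_nbhs_filter strong_nbhs_singleton strong_nbhs_nbhs.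

Definition uniform_operator : Type := L.
HB.instance Definition _ := Choice.on uniform_operator.

Definition uniform_nbhs (T : uniform_operator) : set_system uniform_operator :=
  [set U | exists2 e : R, 0 < e & forall S : L, op_norm (S - T : L) < e -> U S].

HB.instance Definition _ := hasNbhs.Build uniform_operator uniform_nbhs.

Fact uniform_nbhs_filter (T : uniform_operator) : ProperFilter (nbhs T).
Proof.
split; last split.
- by move=> [e e0 /(_ T)]; apply; rewrite subrr op_norm0.
- by exists 1.
- move=> U V [e e0 hU] [d d0 hV]; exists (Num.min e d).
    by rewrite lt_min e0 d0.
  by move=> S; rewrite lt_min => /andP[/hU ? /hV].
- by move=> U V UV [e e0 hU]; exists e => // S /hU /UV.
Qed.

Fact uniform_nbhs_singleton (T : uniform_operator) (U : set uniform_operator) :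
  nbhs T U -> U T.
Proof. by move=> [e e0 /(_ T)]; apply; rewrite subrr op_norm0. Qed.

Fact uniform_nbhs_nbhs (T : uniform_operator) (U : set uniform_operator) :
  nbhs T U -> nbhs T (nbhs^~ U).
Proof.
move=> [e e0 hU]; exists e => // S hS; exists e => // S' hS'; apply: hU.
by rewrite -(subrKA (S : L)); apply: op_normD_lt.
Qed.

HB.instance Definition _ := Nbhs_isNbhsTopological.Build uniform_operator
  uniform_nbhs_filter uniform_nbhs_singleton uniform_nbhs_nbhs.

Definition strong_closed_span (X : set L) : set L :=
  closure (linear_span X : set strong_operator).

Definition uniform_closed_span (X : set L) : set L :=
  closure (linear_span X : set uniform_operator).

Lemma strong_closed_spanP (X : set L) (T : L) :
  strong_closed_span X T <-> forall (s : seq B) (e : R), 0 < e ->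
    exists2 S, linear_span X S & {in s, forall x, c0_norm ((S - T) x) < e}.
Proof.
split=> [h s e e0|h U [s [e [e0 hU]]]].
  have [|S [XS hS]] := h [set S : L | {in s, forall x, c0_norm ((S - T) x) < e}].
    by exists s, e; split.
  by exists S.
by have [S XS hS] := h s e e0; exists S; split=> //; exact: hU.
Qed.

Lemma uniform_closed_spanP (X : set L) (T : L) :
  uniform_closed_span X T <-> forall e : R, 0 < e ->
    exists2 S, linear_span X S & op_norm (S - T) < e.
Proof.
split=> [h e e0|h U [e e0 hU]].
  have [|S [XS hS]] := h [set S : L | op_norm (S - T) < e]; first by exists e.
  by exists S.
by have [S XS hS] := h e e0; exists S; split=> //; exact: hU.
Qed.

Lemma sub_strong_closed_span (X : set L) : linear_span X `<=` strong_closed_span X.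
Proof. exact: (@subset_closure strong_operator). Qed.

Lemma strong_closed_span_linear (X : set L) k S T :
  strong_closed_span X S -> strong_closed_span X T ->
  strong_closed_span X (k *: S + T).
Proof.
move=> /strong_closed_spanP hS /strong_closed_spanP hT.
apply/strong_closed_spanP => s e e0.
have kp : 0 < absv k + 1 :> R by rewrite ltr_wpDl ?absv_ge0.
have [S' XS' hS'] := hS s (e / (absv k + 1)) (divr_gt0 e0 kp).
have [T' XT' hT'] := hT s e e0.
exists (k *: S' + T'); first exact: linear_span_linear.
move=> x xs; rewrite opprD addrACA -scalerBr bounded_opDE.
apply: c0_normD_lt (hT' _ xs).
rewrite bounded_opZE c0_normZ.
have := hS' _ xs; rewrite ltr_pdivlMr //; apply: le_lt_trans.
by rewrite mulrC ler_wpM2l ?c0_norm_ge0 // lerDl.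
Qed.

Lemma strong_closed_spanM (X : set L) S T :
  (forall S T, X S -> X T -> X (S * T)) ->
  strong_closed_span X S -> strong_closed_span X T ->
  strong_closed_span X (S * T).
Proof.
move=> XM /strong_closed_spanP hS /strong_closed_spanP hT.
apply/strong_closed_spanP => s e e0.
have kp : 0 < op_norm S + 1 by rewrite ltr_wpDl ?op_norm_ge0.
have [T' XT' hT'] := hT s (e / (op_norm S + 1)) (divr_gt0 e0 kp).
have [S' XS' hS'] := hS [seq T' x | x <- s] e e0.
exists (S' * T'); first exact: linear_spanM.
move=> x xs; rewrite (_ : S' * T' - S * T = (S' - S) * T' + S * (T' - T)).
  rewrite bounded_opDE; apply: c0_normD_lt.
    by apply: hS'; exact: map_f.
  rewrite bounded_opME; apply: (le_lt_trans (le_op_norm _ _)).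
  have := hT' _ xs; rewrite ltr_pdivlMr //; apply: le_lt_trans.
  by rewrite mulrC ler_wpM2l ?c0_norm_ge0 // lerDl.
by rewrite mulrBl mulrBr addrA subrK.
Qed.

End OperatorTopologies.

Section RegularRepresentations.
Context (R : realType) (G : groupType) (K : completeNonArchFieldType R).
Local Notation B := (c0 G K).
Local Notation L := (bounded_op G K).

Fact vanishing_comp (h : G -> G) (x : B) :
  injective h -> (fun a => x (h a)) \in vanishing G K.
Proof.
move=> hI; apply/asboolP => e e0; have /asboolP/(_ e e0) := valP x.
apply: (@finite_preimage _ _ [set a | e <= absv (x a)] h) => a b _ _.
exact: hI.
Qed.

Fact bounded_linear_comp (h : G -> G) (hI : injective h) :
  (fun x : B => C0 (vanishing_comp x hI)) \in bounded_linear G K.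
Proof.
apply/asboolP; split=> [k x y|]; first by apply/c0P.
exists 1 => x; rewrite mul1r; apply: c0_norm_le => a.
exact: (absv_le_c0_norm x (h a)).
Qed.

Definition right_regular (g : G) : L :=
  BoundedOp (bounded_linear_comp (@mulIg G g)).

Definition left_regular (g : G) : L :=
  BoundedOp (bounded_linear_comp (@mulgI G g^-1%g)).

Lemma right_regularE g (x : B) a : right_regular g x a = x (a * g)%g.
Proof. by []. Qed.

Lemma left_regularE g (x : B) a : left_regular g x a = x (g^-1 * a)%g.
Proof. by []. Qed.

Lemma right_regularM g h :
  right_regular (g * h)%g = right_regular g * right_regular h.
Proof.
by apply/bounded_opP => x; apply/c0P => a; rewrite bounded_opME !right_regularE mulgA.
Qed.

Lemma right_regular1 : right_regular 1%g = 1.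
Proof. by apply/bounded_opP => x; apply/c0P => a; rewrite right_regularE mulg1. Qed.

Definition right_vn : set L := strong_closed_span (range right_regular).

(* [right_vn] as a unital subalgebra in the library's sense. *)
Definition right_vn_algebra : {pred L} := [in right_vn].

Fact right_vn_subalg : subalg_closed right_vn_algebra.
Proof.
split=> [|k S T|S T].
- rewrite inE; apply: sub_strong_closed_span; apply: sub_linear_span.
  by exists 1%g => //; exact: right_regular1.
- by rewrite !inE; exact: strong_closed_span_linear.
- rewrite !inE; apply: strong_closed_spanM => _ _ [g _ <-] [h _ <-].
  by exists (g * h)%g => //; exact: right_regularM.
Qed.

HB.instance Definition _ :=
  GRing.isSubalgClosed.Build K L right_vn_algebra right_vn_subalg.

End RegularRepresentations.
Arguments right_regular {R} G K.
Arguments left_regular {R} G K.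
Arguments right_vn {R} G K.
Arguments right_vn_algebra {R} G K.

Section Reduction.
Context (R : realType) (G : groupType) (K : completeNonArchFieldType R).
Local Notation L := (bounded_op G K).
Local Notation O := (integers K).
Variable A : subalgClosed L.

Definition unit_ball_pred : {pred L} := fun T => (T \in A) && (op_norm T <= 1).

Fact unit_ball_subring : subring_closed unit_ball_pred.
Proof.
split=> [|S T /andP[SA S1] /andP[TA T1]|S T /andP[SA S1] /andP[TA T1]];
  apply/andP; split.
- exact: rpred1.
- by rewrite op_norm1.
- by rewrite -scaleN1r rpredD ?rpredZ.
- by apply: op_normD_le; rewrite ?op_normN.
- exact: rpredM.
- by apply: (le_trans (op_normM _ _)); rewrite mulr_ile1 ?op_norm_ge0.
Qed.

HB.instance Definition _ :=
  GRing.isSubringClosed.Build L unit_ball_pred unit_ball_subring.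

Record unit_ball := UnitBall { unit_ball_val :> L; _ : unit_ball_val \in unit_ball_pred }.

HB.instance Definition _ := [isSub for unit_ball_val].
HB.instance Definition _ := [Choice of unit_ball by <:].
HB.instance Definition _ := [SubChoice_isSubNzRing of unit_ball by <:].

Fact unit_ball_scale_subproof (a : O) (T : unit_ball) :
  val a *: val T \in unit_ball_pred.
Proof.
have /andP[TA T1] := valP T; apply/andP; split; first exact: rpredZ.
apply: (le_trans (op_normZ_le _ _)).
by rewrite mulr_ile1 ?absv_ge0 ?op_norm_ge0 //; exact: (valP a).
Qed.

Definition unit_ball_scale (a : O) (T : unit_ball) : unit_ball :=
  UnitBall (unit_ball_scale_subproof a T).

Fact unit_ball_scaleA a b T :
  unit_ball_scale a (unit_ball_scale b T) = unit_ball_scale (a * b) T.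
Proof. by apply: val_inj; rewrite /= scalerA. Qed.
Fact unit_ball_scale1 : left_id 1 unit_ball_scale.
Proof. by move=> T; apply: val_inj; rewrite /= scale1r. Qed.
Fact unit_ball_scaleDr : right_distributive unit_ball_scale +%R.
Proof. by move=> a S T; apply: val_inj; rewrite /= scalerDr. Qed.
Fact unit_ball_scaleDl T : {morph unit_ball_scale^~ T : a b / a + b}.
Proof. by move=> a b; apply: val_inj; rewrite /= scalerDl. Qed.

HB.instance Definition _ := GRing.Zmodule_isLmodule.Build O unit_ball
  unit_ball_scaleA unit_ball_scale1 unit_ball_scaleDr unit_ball_scaleDl.

Fact unit_ball_scaleAl (a : O) (S T : unit_ball) : a *: (S * T) = (a *: S) * T.
Proof. by apply: val_inj; rewrite /= scalerAl. Qed.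

HB.instance Definition _ :=
  GRing.Lmodule_isLalgebra.Build O unit_ball unit_ball_scaleAl.

Fact unit_ball_scaleAr (a : O) (S T : unit_ball) : a *: (S * T) = S * (a *: T).
Proof. by apply: val_inj; rewrite /= scalerAr. Qed.

HB.instance Definition _ :=
  GRing.Lalgebra_isAlgebra.Build O unit_ball unit_ball_scaleAr.

Definition open_unit_ball : {pred unit_ball} := fun T => op_norm (val T) < 1.

Fact open_unit_ball_zmod : zmod_closed open_unit_ball.
Proof.
split=> [|S T S1 T1]; rewrite unfold_in /=; first by rewrite op_norm0 ltr01.
by rewrite op_normD_lt ?op_normN.
Qed.

HB.instance Definition _ :=
  GRing.isZmodClosed.Build unit_ball open_unit_ball open_unit_ball_zmod.

Lemma open_unit_ballMl S T : T \in open_unit_ball -> S * T \in open_unit_ball.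
Proof.
rewrite !unfold_in => T1; apply: (le_lt_trans (op_normM _ _)).
apply: le_lt_trans T1; rewrite ler_piMl ?op_norm_ge0//.
by have /andP[] := valP S.
Qed.

Lemma open_unit_ballMr S T : S \in open_unit_ball -> S * T \in open_unit_ball.
Proof.
rewrite !unfold_in => S1; apply: (le_lt_trans (op_normM _ _)).
apply: le_lt_trans S1; rewrite ler_piMr ?op_norm_ge0//.
by have /andP[] := valP T.
Qed.

Lemma open_unit_ballZ a T : T \in open_unit_ball -> a *: T \in open_unit_ball.
Proof. by rewrite -mulr_algl; exact: open_unit_ballMl. Qed.

Lemma open_unit_ball_scale a T :
  a \in @maximal_ideal R K -> a *: T \in open_unit_ball.
Proof.
rewrite !unfold_in /= => a1; apply: (le_lt_trans (op_normZ_le _ _)).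
apply: le_lt_trans a1; rewrite ler_piMr ?absv_ge0//.
by have /andP[] := valP T.
Qed.

(* The library makes quotients by ideals into rings only over commutative rings;
   here it gives the quotient group, and the product and the scalar
   multiplication by residues are defined on representatives. *)
Definition reduction := Quotient.quot open_unit_ball.

HB.instance Definition _ := EqQuotient.on reduction.
HB.instance Definition _ := GRing.Zmodule.on reduction.

Lemma reduction_eq (S T : unit_ball) :
  (\pi_(reduction) S == \pi_(reduction) T) = (S - T \in open_unit_ball).
Proof. by rewrite -Quotient.idealrBE. Qed.

Lemma repr_reduction (T : unit_ball) :
  T - repr (\pi_(reduction) T) \in open_unit_ball.
Proof. by rewrite -reduction_eq reprK. Qed.

Lemma repr_residue (a : O) :
  a - repr (\pi_(residue_field K) a) \in @maximal_ideal R K.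
Proof. by rewrite Quotient.idealrBE reprK. Qed.

Definition reduction_one : reduction := \pi_(reduction) 1.

Definition reduction_mul (x y : reduction) : reduction :=
  \pi_(reduction) (repr x * repr y).

Definition reduction_scale (a : residue_field K) (x : reduction) : reduction :=
  \pi_(reduction) (repr a *: repr x).

Lemma reduction_piD S T :
  \pi_(reduction) S + \pi_(reduction) T = \pi_(reduction) (S + T).
Proof. by rewrite [LHS]piE. Qed.

Lemma reduction_piM S T :
  reduction_mul (\pi_(reduction) S) (\pi_(reduction) T) = \pi_(reduction) (S * T).
Proof.
apply/esym/eqP; rewrite reduction_eq.
set S' := repr _; set T' := repr _.
rewrite (_ : _ - _ = (S - S') * T + S' * (T - T')).
  apply: rpredD; first exact/open_unit_ballMr/repr_reduction.
  exact/open_unit_ballMl/repr_reduction.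
by rewrite mulrBl mulrBr addrA subrK.
Qed.

Lemma reduction_piZ a T :
  reduction_scale (\pi_(residue_field K) a) (\pi_(reduction) T) = \pi_(reduction) (a *: T).
Proof.
apply/esym/eqP; rewrite reduction_eq.
set a' := repr _; set T' := repr _.
rewrite (_ : _ - _ = (a - a') *: T + a' *: (T - T')).
  apply: rpredD; first exact/open_unit_ball_scale/repr_residue.
  exact/open_unit_ballZ/repr_reduction.
by rewrite scalerBl scalerBr addrA subrK.
Qed.

Fact reduction_mulA : associative reduction_mul.
Proof.
elim/quotW=> x; elim/quotW=> y; elim/quotW=> z.
by rewrite (reduction_piM y z) (reduction_piM x y) !reduction_piM mulrA.
Qed.
Fact reduction_mul1l : left_id reduction_one reduction_mul.
Proof. by elim/quotW=> x; rewrite reduction_piM mul1r. Qed.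
Fact reduction_mul1r : right_id reduction_one reduction_mul.
Proof. by elim/quotW=> x; rewrite reduction_piM mulr1. Qed.
Fact reduction_mulDl : left_distributive reduction_mul +%R.
Proof.
elim/quotW=> x; elim/quotW=> y; elim/quotW=> z.
rewrite (reduction_piD x y) (reduction_piM x z) (reduction_piM y z).
by rewrite reduction_piM reduction_piD mulrDl.
Qed.
Fact reduction_mulDr : right_distributive reduction_mul +%R.
Proof.
elim/quotW=> x; elim/quotW=> y; elim/quotW=> z.
rewrite (reduction_piD y z) (reduction_piM x y) (reduction_piM x z).
by rewrite reduction_piM reduction_piD mulrDr.
Qed.
Fact reduction_one_neq0 : reduction_one != 0.
Proof.
rewrite (_ : 0 = \pi_(reduction) 0); last by rewrite [LHS]piE.
by rewrite reduction_eq subr0 unfold_in /= op_norm1 ltxx.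
Qed.

HB.instance Definition _ := GRing.Zmodule_isNzRing.Build reduction
  reduction_mulA reduction_mul1l reduction_mul1r
  reduction_mulDl reduction_mulDr reduction_one_neq0.

Lemma residue_piD (a b : O) :
  \pi_(residue_field K) a + \pi_(residue_field K) b = \pi_(residue_field K) (a + b).
Proof. by rewrite [LHS]piE. Qed.
Lemma residue_piM (a b : O) :
  \pi_(residue_field K) a * \pi_(residue_field K) b = \pi_(residue_field K) (a * b).
Proof. by rewrite [LHS]piE. Qed.
Lemma residue_pi1 : \pi_(residue_field K) 1 = 1.
Proof. by rewrite [RHS]piE. Qed.

Fact reduction_scaleA a b x :
  reduction_scale a (reduction_scale b x) = reduction_scale (a * b) x.
Proof.
elim/quotW: a => a; elim/quotW: b => b; elim/quotW: x => x.
by rewrite (residue_piM a b) (reduction_piZ b x) !reduction_piZ scalerA.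
Qed.
Fact reduction_scale1 : left_id 1 reduction_scale.
Proof. by elim/quotW=> x; rewrite -residue_pi1 reduction_piZ scale1r. Qed.
Fact reduction_scaleDr : right_distributive reduction_scale +%R.
Proof.
elim/quotW=> a; elim/quotW=> x; elim/quotW=> y.
rewrite (reduction_piD x y) (reduction_piZ a x) (reduction_piZ a y).
by rewrite reduction_piZ reduction_piD scalerDr.
Qed.
Fact reduction_scaleDl x : {morph reduction_scale^~ x : a b / a + b}.
Proof.
elim/quotW: x => x; elim/quotW=> a; elim/quotW=> b.
rewrite (residue_piD a b) (reduction_piZ a x) (reduction_piZ b x).
by rewrite reduction_piZ reduction_piD scalerDl.
Qed.

HB.instance Definition _ :=
  GRing.Zmodule_isLmodule.Build (residue_field K) reduction
    reduction_scaleA reduction_scale1 reduction_scaleDr reduction_scaleDl.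

Fact reduction_scaleAl (a : residue_field K) (x y : reduction) :
  a *: (x * y) = (a *: x) * y.
Proof.
elim/quotW: a => a; elim/quotW: x => x; elim/quotW: y => y.
transitivity (\pi_(reduction) (a *: (x * y))); last first.
  rewrite scalerAl; apply/esym; rewrite -[RHS]reduction_piM.
  by congr (_ * _); exact: reduction_piZ.
rewrite -[RHS]reduction_piZ; congr (_ *: _); exact: reduction_piM.
Qed.

HB.instance Definition _ :=
  GRing.Lmodule_isLalgebra.Build (residue_field K) reduction reduction_scaleAl.

Fact reduction_scaleAr (a : residue_field K) (x y : reduction) :
  a *: (x * y) = x * (a *: y).
Proof.
elim/quotW: a => a; elim/quotW: x => x; elim/quotW: y => y.
transitivity (\pi_(reduction) (a *: (x * y))); last first.
  rewrite scalerAr; apply/esym; rewrite -[RHS]reduction_piM.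
  by congr (_ * _); exact: reduction_piZ.
rewrite -[RHS]reduction_piZ; congr (_ *: _); exact: reduction_piM.
Qed.

HB.instance Definition _ :=
  GRing.Lalgebra_isAlgebra.Build (residue_field K) reduction reduction_scaleAr.

End Reduction.
Arguments reduction {R G K} A.

Section GroupAlgebra.
Context (k : fieldType) (G : groupType).

Definition finitely_supported : {pred G -> k^o} := fun f =>
  `[< finite_set [set a | f a != 0] >].

Fact finitely_supported_submod : submod_closed finitely_supported.
Proof.
split=> [|c f h /asboolP hf /asboolP hh]; apply/asboolP.
  by rewrite (_ : [set _ | _] = set0) //; apply/seteqP; split=> a //=; rewrite eqxx.
have : finite_set ([set a | f a != 0] `|` [set a | h a != 0]).
  by rewrite finite_setU.
apply: sub_finite_set => a /=; apply: contraPP => /not_orP[].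
move=> /negP/negPn/eqP f0 /negP/negPn/eqP h0; apply/negP/negPn.
by rewrite !fctE f0 h0 scaler0 addr0.
Qed.

HB.instance Definition _ :=
  GRing.isSubmodClosed.Build k (G -> k^o) finitely_supported
    finitely_supported_submod.

Record group_algebra := GroupAlgebra {
  group_algebra_val :> G -> k^o;
  _ : group_algebra_val \in finitely_supported }.

HB.instance Definition _ := [isSub for group_algebra_val].
HB.instance Definition _ := [Choice of group_algebra by <:].
HB.instance Definition _ := [SubChoice_isSubLmodule of group_algebra by <:].

Implicit Types f h l : group_algebra.

Lemma group_algebraP f h : (forall a, f a = h a) <-> f = h.
Proof. by split=> [e|->//]; apply: val_inj; apply: funext. Qed.

Lemma group_algebraDE f h a : (f + h) a = f a + h a. Proof. by []. Qed.
Lemma group_algebraZE c f a : (c *: f) a = c * f a. Proof. by []. Qed.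

Lemma group_algebra_supp f : exists2 s : seq G,
  uniq s & forall a, f a != 0 -> a \in s.
Proof.
have /asboolP/finite_seqP[s hs] := valP f.
exists (undup s); first exact: undup_uniq.
move=> a fa; rewrite mem_undup.
by have : [set` s] a by rewrite -hs.
Qed.

Lemma fsum_seq (F : G -> k) (s : seq G) :
  uniq s -> (forall a, F a != 0 -> a \in s) ->
  \sum_(a \in [set: G]) F a = \sum_(a <- s) F a.
Proof.
move=> us hs; rewrite fsbig_supp; apply: fsbig_fwiden => //.
  by move=> a [_ /= /eqP/hs].
move=> a [_ /= h]; apply: contrapT => Fa; exact: h.
Qed.

(* A sum over all of G, with finitely many nonzero terms when [f] is finitely
   supported. *)
Definition convolution (f h : G -> k) (b : G) : k :=
  \sum_(a \in [set: G]) f a * h (a^-1 * b)%g.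

Lemma convolutionE (f h : G -> k) (s : seq G) b :
  uniq s -> (forall a, f a != 0 -> a \in s) ->
  convolution f h b = \sum_(a <- s) f a * h (a^-1 * b)%g.
Proof.
move=> us hs; apply: fsum_seq => // a; rewrite mulf_eq0 negb_or => /andP[+ _].
exact: hs.
Qed.

Fact group_algebra_mul_subproof f h :
  (convolution f h : G -> k^o) \in finitely_supported.
Proof.
have [s us hs] := group_algebra_supp f; have [t ut ht] := group_algebra_supp h.
apply/asboolP; apply: (@sub_finite_set _ _ [set` [seq (a * b)%g | a <- s, b <- t]]).
  move=> b /=; apply: contraR => hb; rewrite (convolutionE _ _ us hs).
  rewrite big_seq big1 // => a sa; apply/eqP; rewrite mulf_eq0; apply/orP; right.
  apply: contraR hb => /ht tb; apply/allpairsP; exists (a, (a^-1 * b)%g).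
  by rewrite /= mulVKg.
exact: finite_seq.
Qed.
Definition group_algebra_mul f h := GroupAlgebra (group_algebra_mul_subproof f h).

Fact group_algebra_one_subproof :
  (fun a : G => (a == 1%g)%:R : k^o) \in finitely_supported.
Proof.
apply/asboolP; apply: (@sub_finite_set _ _ [set 1%g]) => // a /=.
by have [->//|_] := eqVneq a 1%g; rewrite eqxx.
Qed.
Definition group_algebra_one := GroupAlgebra group_algebra_one_subproof.

Fact group_algebra_mulA : associative group_algebra_mul.
Proof.
move=> f h l; apply/group_algebraP => g /=.
have [s us hs] := group_algebra_supp f.
have [t ut ht] := group_algebra_supp (group_algebra_mul f h).
rewrite (convolutionE _ _ us hs).
have [s' us' hs'] := group_algebra_supp h.
pose w := undup (t ++ [seq (a * b)%g | a <- s, b <- s']).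
have uw : uniq w by rewrite undup_uniq.
rewrite (@convolutionE _ _ w) //; last first.
  by move=> a /ht ta; rewrite mem_undup mem_cat ta.
under [RHS]eq_bigr do rewrite (convolutionE _ _ us hs) mulr_suml.
rewrite exchange_big /=; apply: eq_big_seq => a sa.
under [RHS]eq_bigr do rewrite -mulrA.
rewrite -mulr_sumr; congr (_ * _).
rewrite /convolution (reindex_fsbigT (fun b => (a^-1 * b)%g)) /=; last first.
  by exists (fun b => (a * b)%g) => b; rewrite ?mulKg ?mulVKg.
rewrite (@fsum_seq _ w) //.
  by apply: eq_bigr => b _; rewrite invgM invgK mulgA mulgK.
move=> b; rewrite mulf_eq0 negb_or => /andP[/hs' sb _].
rewrite mem_undup mem_cat; apply/orP; right; apply/allpairsP.
by exists (a, (a^-1 * b)%g); rewrite /= mulVKg.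
Qed.

Fact group_algebra_mul1l : left_id group_algebra_one group_algebra_mul.
Proof.
move=> f; apply/group_algebraP => g /=.
rewrite (@convolutionE _ _ [:: 1%g]) //.
  by rewrite big_seq1 eqxx mul1r invg1 mul1g.
by move=> a; rewrite inE /=; case: (a == 1%g); rewrite ?eqxx.
Qed.

Fact group_algebra_mul1r : right_id group_algebra_one group_algebra_mul.
Proof.
move=> f; apply/group_algebraP => g /=.
rewrite /convolution (@fsum_seq _ [:: g]) //.
  by rewrite big_seq1 mulVg eqxx mulr1.
move=> a; rewrite inE; apply: contraR => ag.
rewrite (_ : _ == 1%g = false) ?mulr0 //; apply: contra_neqF ag => /eqP e.
by rewrite -[g](mulVKg a) e mulg1.
Qed.

Fact group_algebra_mulDl : left_distributive group_algebra_mul +%R.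
Proof.
move=> f h l; apply/group_algebraP => g.
have [s us hs] := group_algebra_supp f; have [t ut ht] := group_algebra_supp h.
pose w := undup (s ++ t); have uw : uniq w by rewrite undup_uniq.
have sw a : f a != 0 -> a \in w by move=> /hs; rewrite mem_undup mem_cat => ->.
have tw a : h a != 0 -> a \in w.
  by move=> /ht; rewrite mem_undup mem_cat orbC => ->.
have fhw a : (f + h) a != 0 -> a \in w.
  rewrite group_algebraDE; have [fa|/sw//] := eqVneq (f a) 0.
  by rewrite fa add0r; exact: tw.
rewrite [RHS]group_algebraDE.
rewrite [LHS](convolutionE _ _ uw fhw).
rewrite [X in _ = X + _](convolutionE _ _ uw sw).
rewrite [X in _ = _ + X](convolutionE _ _ uw tw) -big_split.
by apply: eq_bigr => a _; rewrite group_algebraDE mulrDl.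
Qed.

Fact group_algebra_mulDr : right_distributive group_algebra_mul +%R.
Proof.
move=> f h l; apply/group_algebraP => g.
have [s us hs] := group_algebra_supp f.
rewrite [RHS]group_algebraDE.
rewrite [LHS](convolutionE _ _ us hs) [X in _ = X + _](convolutionE _ _ us hs).
rewrite [X in _ = _ + X](convolutionE _ _ us hs) -big_split.
by apply: eq_bigr => a _; rewrite group_algebraDE mulrDr.
Qed.

Fact group_algebra_one_neq0 : group_algebra_one != 0.
Proof.
apply/eqP => /group_algebraP/(_ 1%g) /=.
by rewrite eqxx => /eqP; rewrite oner_eq0.
Qed.

HB.instance Definition _ := GRing.Zmodule_isNzRing.Build group_algebra
  group_algebra_mulA group_algebra_mul1l group_algebra_mul1r
  group_algebra_mulDl group_algebra_mulDr group_algebra_one_neq0.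

Fact group_algebra_scaleAl (c : k) f h : c *: (f * h) = (c *: f) * h.
Proof.
apply/group_algebraP => g.
have [s us hs] := group_algebra_supp f.
have cs a : (c *: f) a != 0 -> a \in s.
  by rewrite group_algebraZE mulf_eq0 negb_or => /andP[_ /hs].
rewrite [LHS]group_algebraZE.
rewrite [X in c * X](convolutionE _ _ us hs) [RHS](convolutionE _ _ us cs).
by rewrite mulr_sumr; apply: eq_bigr => a _; rewrite group_algebraZE mulrA.
Qed.

HB.instance Definition _ :=
  GRing.Lmodule_isLalgebra.Build k group_algebra group_algebra_scaleAl.

Fact group_algebra_scaleAr (c : k) f h : c *: (f * h) = f * (c *: h).
Proof.
apply/group_algebraP => g.
have [s us hs] := group_algebra_supp f.
rewrite [LHS]group_algebraZE.
rewrite [X in c * X](convolutionE _ _ us hs) [RHS](convolutionE _ _ us hs).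
by rewrite mulr_sumr; apply: eq_bigr => a _; rewrite group_algebraZE mulrCA.
Qed.

HB.instance Definition _ :=
  GRing.Lalgebra_isAlgebra.Build k group_algebra group_algebra_scaleAr.

End GroupAlgebra.

Definition conjugates (G : groupType) (a : G) : set G :=
  range (fun c => (c^-1 * a * c)%g).

(* Main.v *)
Require Import Defs.
From HB Require Import structures.
From mathcomp Require Import all_boot all_order all_algebra.
From mathcomp Require Import all_classical all_reals topology.

Set Implicit Arguments.
Unset Strict Implicit.
Unset Printing Implicit Defensive.

Import Order.TTheory GRing.Theory Num.Theory.

Local Open Scope classical_set_scope.
Local Open Scope ring_scope.

(** An operator [T] commuting with the left translations is determined by
    [t = T (delta 1)], isometrically: [T (delta g)] is the translate of [t] by [g],
    and in the ultrametric setting the norm of an operator is the supremum of its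
    values on the [delta g].  Truncating [t] to a finite set therefore approximates
    [T] in operator norm by combinations of right translations, so that the
    commutant of one family lies in the uniform closed span of the other; the
    strong closure cannot leave that commutant.  The residues of the coefficients
    of [t] give the isomorphism with the group algebra.  A central element has [t]
    constant on conjugacy classes, so only scalars remain when the nontrivial
    classes are infinite, while the sum of the translations over a finite class is
    central. *)

(** * Unit vectors of $c_0(G,K)$ and operator norms *)

Section Delta.
Context (R : realType) (G : groupType) (K : completeNonArchFieldType R).
Local Notation B := (c0 G K).
Local Notation L := (bounded_op G K).
Implicit Types (x : B) (T : L).

Fact delta_subproof (g : G) : (fun a : G => (a == g)%:R : K^o) \in vanishing G K.
Proof.
apply/asboolP => e e0; apply: (@sub_finite_set _ _ [set g]) => // a /=.
by case: eqP => //= _; rewrite absv0 leNgt e0.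
Qed.
Definition delta (g : G) : B := C0 (delta_subproof g).

Lemma deltaE g a : delta g a = (a == g)%:R. Proof. by []. Qed.

Lemma c0_norm0 : c0_norm (0 : B) = 0.
Proof. by apply/eqP; rewrite c0_norm_eq0. Qed.

Lemma c0_sumE (I : Type) (s : seq I) (F : I -> B) a :
  (\sum_(i <- s) F i) a = \sum_(i <- s) F i a.
Proof. by elim/big_ind2: _ => // x y x' y' <- <-. Qed.

Lemma bounded_op_sumE (I : Type) (s : seq I) (F : I -> L) x :
  (\sum_(i <- s) F i) x = \sum_(i <- s) F i x.
Proof. by elim/big_ind2: _ => // S y T y' <- <-. Qed.

Lemma c0_norm_sum_le (I : eqType) (s : seq I) (F : I -> B) (c : R) : 0 <= c ->
  (forall i, i \in s -> c0_norm (F i) <= c) -> c0_norm (\sum_(i <- s) F i) <= c.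
Proof.
move=> c_ge0 Fc; rewrite big_seq.
apply: (big_ind (fun x => c0_norm x <= c)) => //; first by rewrite c0_norm0.
by move=> x y; exact: c0_normD_le.
Qed.

(** Strictness survives the supremum because only finitely many coordinates reach [c / 2]; all
    others stay below [c / 2 < c]. *)
Lemma c0_norm_lt x (c : R) : 0 < c -> (forall a, absv (x a) < c) -> c0_norm x < c.
Proof.
move=> c_gt0 xc; have c2 : 0 < c / 2 by rewrite divr_gt0.
have /asboolP/(_ _ c2)/finite_seqP[s xs] := valP x.
apply: (@le_lt_trans _ _ (\big[Num.max/c / 2]_(a <- s) absv (x a))).
  apply: c0_norm_le => a; have [xa|/ltW xa] := leP (c / 2) (absv (x a)).
    apply: (@le_bigmax_seq _ _ _ s (c / 2) a xpredT (fun a => absv (x a))) => //.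
    by have : [set` s] a by rewrite -xs.
  exact: le_trans xa (bigmax_ge_id _ _ _ _).
have c2c : c / 2 < c by rewrite ltr_pdivrMr // ltr_pMr // ltr1n.
by elim/big_ind: _ => // u v uc vc; rewrite gt_max uc vc.
Qed.

Lemma c0_norm_delta g : c0_norm (delta g) = 1 :> R.
Proof.
apply/le_anti/andP; split.
  apply: c0_norm_le => a; rewrite deltaE.
  by case: eqP => _; rewrite ?absv1 ?absv0.
by have := absv_le_c0_norm (delta g) g; rewrite deltaE eqxx absv1.
Qed.

Lemma sum_delta (s : seq G) (c : G -> K) a : uniq s ->
  (\sum_(g <- s) c g *: delta g : B) a = (a \in s)%:R * c a.
Proof.
move=> us; rewrite c0_sumE; under eq_bigr do rewrite c0ZE deltaE.
have [sa|sa] := boolP (a \in s); last first.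
  rewrite mul0r big_seq big1 // => g sg.
  by case: eqP sg sa => [->->//|]; rewrite mulr0.
rewrite (big_rem a) //= eqxx mulr1 mul1r big_seq big1 ?addr0 // => g.
by rewrite mem_rem_uniq // inE eq_sym => /andP[/negPf-> _]; rewrite mulr0.
Qed.

Lemma c0_approx x (e : R) : 0 < e -> exists2 s : seq G, uniq s &
  c0_norm (x - \sum_(g <- s) x g *: delta g) < e.
Proof.
move=> e0; have /asboolP/(_ _ e0)/finite_seqP[s xs] := valP x.
exists (undup s); first exact: undup_uniq.
apply: c0_norm_lt => // a; rewrite c0DE c0NE sum_delta ?undup_uniq // mem_undup.
have [sa|sa] := boolP (a \in s); first by rewrite mul1r subrr absv0.
rewrite mul0r subr0 ltNge; apply: contra sa => xa.
by have : [set` s] a by rewrite -xs.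
Qed.

(** If [T x] exceeded the bound, a finite truncation [y] of [x] would make [T (x - y)] smaller than
    [T x], while the ultrametric inequality bounds [T y] by [C * c0_norm x]; their sum [T x] would
    then be smaller than itself. *)
Lemma op_norm_le_delta T (C : R) :
  (forall g, c0_norm (T (delta g)) <= C) -> op_norm T <= C.
Proof.
move=> hC; have C0 : 0 <= C := le_trans (c0_norm_ge0 _) (hC 1%g).
apply: op_norm_le => x; rewrite leNgt; apply/negP => ltT.
have T0 : 0 < c0_norm (T x).
  by apply: le_lt_trans ltT; rewrite mulr_ge0 ?c0_norm_ge0.
(* The [+ 1] makes the divisor positive without a case distinction on the norm. *)
have D0 : 0 < op_norm T + 1 by rewrite ltr_wpDl ?op_norm_ge0.
have [s us hs] := c0_approx x (divr_gt0 T0 D0).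
suff : c0_norm (T x) < c0_norm (T x) by rewrite ltxx.
pose y := \sum_(g <- s) x g *: delta g.
rewrite [X in c0_norm X < _](_ : T x = T (x - y) + T y); last first.
  by rewrite -linearD subrK.
apply: c0_normD_lt.
  apply: (le_lt_trans (le_op_norm _ _)); move: hs; rewrite ltr_pdivlMr //.
  by apply: le_lt_trans; rewrite mulrC ler_wpM2l ?c0_norm_ge0 // lerDl.
apply: le_lt_trans ltT; rewrite linear_sum; apply: c0_norm_sum_le => [|g _].
  by rewrite mulr_ge0 ?c0_norm_ge0.
rewrite linearZ c0_normZ mulrC ler_pM ?c0_norm_ge0 ?absv_ge0 //.
  exact: hC.
exact: absv_le_c0_norm.
Qed.

Lemma right_regular_delta g h :
  right_regular G K g (delta h) = delta (h * g^-1)%g.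
Proof.
by apply/c0P => a; rewrite right_regularE !deltaE -(can2_eq (mulgK g) (mulgVK g)).
Qed.

Lemma left_regular_delta g h : left_regular G K g (delta h) = delta (g * h)%g.
Proof.
by apply/c0P => a; rewrite left_regularE !deltaE (can2_eq (mulVKg g) (mulKg g)).
Qed.

Lemma regular_comm g h :
  right_regular G K g * left_regular G K h = left_regular G K h * right_regular G K g.
Proof.
by apply/bounded_opP => x; apply/c0P => a;
  rewrite !bounded_opME right_regularE !left_regularE right_regularE mulgA.
Qed.

Lemma right_regular_contraction g x : c0_norm (right_regular G K g x) <= c0_norm x.
Proof. by apply: c0_norm_le => a; exact: (absv_le_c0_norm x (a * g)%g). Qed.

Lemma left_regular_contraction g x : c0_norm (left_regular G K g x) <= c0_norm x.
Proof. by apply: c0_norm_le => a; exact: (absv_le_c0_norm x (g^-1 * a)%g). Qed.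

End Delta.
Arguments delta {R G} K g.

(** * Commutants and closed spans in the two topologies *)

Section Commutants.
Context (R : realType) (G : groupType) (K : completeNonArchFieldType R).
Local Notation B := (c0 G K).
Local Notation L := (bounded_op G K).
Implicit Types (X Y : set L) (S T : L).

Lemma commutantS (A : pzRingType) (X Y : set A) :
  X `<=` Y -> commutant Y `<=` commutant X.
Proof. by move=> XY a ha x /XY; exact: ha. Qed.

Lemma linear_span_commutant X Y :
  X `<=` commutant Y -> linear_span X `<=` commutant Y.
Proof.
move=> XY _ [s sX ->] y Yy; rewrite mulr_suml mulr_sumr.
rewrite big_seq [RHS]big_seq; apply: eq_bigr => p /sX/XY/(_ _ Yy) pY.
by rewrite -scalerAl pY scalerAr.
Qed.

(** Commutation with [y], tested at [x], involves [T] only at the two vectors [y x] and [x], so it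
    passes to strong limits. *)
Lemma strong_closed_span_commutant X Y :
  X `<=` commutant Y -> strong_closed_span X `<=` commutant Y.
Proof.
move=> /linear_span_commutant XY T /strong_closed_spanP hT y Yy.
apply/bounded_opP => x; rewrite !bounded_opME; apply/subr0_eq/eqP.
rewrite -c0_norm_eq0 eq_le c0_norm_ge0 andbT leNgt; apply/negP => n0.
set n := c0_norm _ in n0.
have D0 : 0 < op_norm y + 1 by rewrite ltr_wpDl ?op_norm_ge0.
have e0 : 0 < Num.min n (n / (op_norm y + 1)) by rewrite lt_min n0 divr_gt0.
have [S /XY/(_ _ Yy)/bounded_opP/(_ x) + hS] := hT [:: y x; x] _ e0.
rewrite !bounded_opME => Sy.
suff : n < n by rewrite ltxx.
have := hS (y x); rewrite mem_head lt_min => /(_ isT)/andP[hyx _].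
have := hS x; rewrite !inE eqxx orbT lt_min => /(_ isT)/andP[_ hx].
(* Since [S] commutes with [y], the commutator of [T] and [y] at [x] is expressed by the error
   [S - T] alone; both terms are below [n], hence so is their sum, whose norm is [n]. *)
rewrite {1}/n (_ : _ - _ = - ((S - T) (y x)) + y ((S - T) x)); last first.
  by rewrite !(bounded_opDE, bounded_opNE) opprB (linearB y) Sy addrA addrNK.
apply: c0_normD_lt; first by rewrite c0_normN.
apply: (le_lt_trans (le_op_norm _ _)); move: hx; rewrite ltr_pdivlMr //.
by apply: le_lt_trans; rewrite mulrC ler_wpM2l ?c0_norm_ge0 // lerDl.
Qed.

Lemma commutant_strong_closed_span X :
  commutant (strong_closed_span X) = commutant X.
Proof.
apply/seteqP; split.
  by apply: commutantS => T XT; exact/sub_strong_closed_span/sub_linear_span.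
move=> T hT S XS; apply/esym.
(* Commutation is symmetric: [T] commutes with [X] exactly when [X] lies in the commutant of [T],
   which is strongly closed. *)
by apply: (strong_closed_span_commutant _ XS (Y := [set T])) => // S' XS' _ ->; rewrite hT.
Qed.

Lemma uniform_sub_strong_closed_span X :
  uniform_closed_span X `<=` strong_closed_span X.
Proof.
move=> T /uniform_closed_spanP hT; apply/strong_closed_spanP => s e e0.
(* The default value 1 keeps [m] positive, even for an empty [s]. *)
pose m := \big[Num.max/1]_(x <- s) c0_norm x.
have m0 : 0 < m := lt_le_trans ltr01 (bigmax_ge_id _ _ _ _).
have [S XS hS] := hT _ (divr_gt0 e0 m0); exists S => // x xs.
apply: (le_lt_trans (le_op_norm _ _)); move: hS; rewrite ltr_pdivlMr //.
apply: le_lt_trans; rewrite ler_wpM2l ?op_norm_ge0 //.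
exact: (@le_bigmax_seq _ _ _ s 1 x xpredT (fun x => c0_norm x)).
Qed.

(** * Two commuting families sharing the cyclic vector [delta 1] *)

Section Cyclic.
Variables X Y : set L.
Hypothesis XY : X `<=` commutant Y.
Hypothesis Y_contraction : forall S, Y S -> forall x, c0_norm (S x) <= c0_norm x.
Hypothesis X_delta : forall g, exists2 S, X S & S (delta K 1%g) = delta K g.
Hypothesis Y_delta : forall g, exists2 S, Y S & S (delta K 1%g) = delta K g.

(** Some contraction [S] in [Y] sends [delta 1] to [delta g], and [T (delta g) = S (T (delta 1))] is
    then no larger than [T (delta 1)]; the values on the [delta g] bound the norm. *)
Lemma op_norm_commutant T : commutant Y T -> op_norm T = c0_norm (T (delta K 1%g)).
Proof.
move=> YT; apply/le_anti/andP; split.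
  apply: op_norm_le_delta => g; have [S YS <-] := Y_delta g.
  by rewrite -bounded_opME YT // bounded_opME Y_contraction.
by apply: (le_trans (le_op_norm _ _)); rewrite c0_norm_delta mulr1.
Qed.

(** Truncate [T (delta 1)] to finitely many [delta g] and replace each by an element of [X]
    producing it from [delta 1]. The resulting [S] commutes with [Y] like [T], so [op_norm (S - T)]
    is just the norm of the discarded tail. *)
Lemma commutant_sub_uniform_closed_span : commutant Y `<=` uniform_closed_span X.
Proof.
move=> T YT; apply/uniform_closed_spanP => e e0.
have [s us hs] := c0_approx (T (delta K 1%g)) e0.
pose P g : L := projT1 (cid2 (X_delta g)).
have PX g : X (P g) by rewrite /P; case: cid2.
have Pd g : P g (delta K 1%g) = delta K g by rewrite /P; case: cid2.
pose S := \sum_(p <- [seq (T (delta K 1%g) g : K, P g) | g <- s]) p.1 *: p.2.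
have XS : linear_span X S.
  by eexists; last reflexivity; move=> p /mapP[g _ ->]; exact: PX.
have YS := linear_span_commutant XY XS.
exists S => //; rewrite op_norm_commutant; last first.
  by move=> y Yy; rewrite mulrBl mulrBr YT // YS.
rewrite -c0_normN -bounded_opNE opprB bounded_opDE bounded_opNE.
rewrite /S big_map bounded_op_sumE.
by under eq_bigr do rewrite bounded_opZE Pd.
Qed.

Lemma strong_closed_spanE : strong_closed_span X = commutant Y.
Proof.
apply/seteqP; split; first exact: strong_closed_span_commutant.
by move=> T /commutant_sub_uniform_closed_span /uniform_sub_strong_closed_span.
Qed.

Lemma uniform_closed_spanE : uniform_closed_span X = commutant Y.
Proof.
apply/seteqP; split; last exact: commutant_sub_uniform_closed_span.
by rewrite -strong_closed_spanE; exact: uniform_sub_strong_closed_span.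
Qed.

End Cyclic.
End Commutants.

(** * The regular representations, the center and conjugacy classes *)

Section RegularClosures.
Context (R : realType) (G : groupType) (K : completeNonArchFieldType R).
Local Notation B := (c0 G K).
Local Notation L := (bounded_op G K).
Local Notation U := (range (right_regular G K)).
Local Notation V := (range (left_regular G K)).
Local Notation e1 := (delta K (1%g : G)).
Implicit Types S T : L.

Lemma right_sub_commutant_left : U `<=` commutant V.
Proof. by move=> _ [g _ <-] _ [h _ <-]; exact: regular_comm. Qed.

Lemma left_sub_commutant_right : V `<=` commutant U.
Proof. by move=> _ [g _ <-] _ [h _ <-]; rewrite regular_comm. Qed.

Lemma right_contraction S : U S -> forall x, c0_norm (S x) <= c0_norm x.
Proof. by move=> [g _ <-]; exact: right_regular_contraction. Qed.

Lemma left_contraction S : V S -> forall x, c0_norm (S x) <= c0_norm x.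
Proof. by move=> [g _ <-]; exact: left_regular_contraction. Qed.

Lemma right_regular_cyclic g : exists2 S, U S & S e1 = delta K g.
Proof.
exists (right_regular G K g^-1%g); first by exists g^-1%g.
by rewrite right_regular_delta mul1g invgK.
Qed.

Lemma left_regular_cyclic g : exists2 S, V S & S e1 = delta K g.
Proof.
exists (left_regular G K g); first by exists g.
by rewrite left_regular_delta mulg1.
Qed.

Lemma right_strong_closed_span : strong_closed_span U = commutant V.
Proof.
exact: strong_closed_spanE right_sub_commutant_left left_contraction
  right_regular_cyclic left_regular_cyclic.
Qed.

Lemma right_uniform_closed_span : uniform_closed_span U = commutant V.
Proof.
exact: uniform_closed_spanE right_sub_commutant_left left_contraction
  right_regular_cyclic left_regular_cyclic.
Qed.

Lemma left_strong_closed_span : strong_closed_span V = commutant U.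
Proof.
exact: strong_closed_spanE left_sub_commutant_right right_contraction
  left_regular_cyclic right_regular_cyclic.
Qed.

Lemma op_norm_right_vn T : commutant V T -> op_norm T = c0_norm (T e1).
Proof. exact: op_norm_commutant left_contraction left_regular_cyclic _. Qed.

(** Translating by [c] on both the left and the right fixes [delta 1]; since [T] commutes with both
    translations, [T (delta 1)] is fixed too. *)
Lemma center_class_function T a c :
  commutant U T -> commutant V T -> T e1 (c^-1 * a * c)%g = T e1 a.
Proof.
move=> UT VT.
have -> : T e1 a = T (right_regular G K c (left_regular G K c e1)) a.
  by rewrite left_regular_delta right_regular_delta mulg1 mulgV.
rewrite -bounded_opME UT; last by exists c.
rewrite bounded_opME -(bounded_opME T) VT; last by exists c.
by rewrite bounded_opME right_regularE left_regularE mulgA.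
Qed.

(** The operator [T - k%:A] commutes with the left translations and kills [delta 1], so its norm is
    0. *)
Lemma scalar_of_delta T k : commutant V T -> T e1 = k *: e1 -> T = k%:A.
Proof.
move=> VT Te; apply/subr0_eq/bounded_opP => x; apply/eqP.
rewrite -c0_norm_eq0 eq_le c0_norm_ge0 andbT.
apply: (le_trans (le_op_norm _ _)); rewrite op_norm_right_vn.
  rewrite bounded_opDE bounded_opNE bounded_opZE bounded_op1E Te subrr.
  by rewrite c0_norm0 mul0r.
by move=> S VS; rewrite mulrBl mulrBr VT // -scalerAl -scalerAr mul1r mulr1.
Qed.

(** A nonzero coordinate at some [a] other than 1 would recur along the infinite class of [a], and
    [T (delta 1)] would not tend to 0. *)
Lemma icc_center_scalar T : (forall a : G, a <> 1%g -> infinite_set (conjugates a)) ->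
  commutant U T -> commutant V T -> T = (T e1 1%g : K)%:A.
Proof.
move=> icc UT VT; apply: scalar_of_delta => //.
apply/c0P => a; rewrite c0ZE deltaE; case: eqP => [->|a1]; first by rewrite mulr1.
rewrite mulr0; apply: contrapT => /eqP Ta; apply: (icc _ a1).
have Ta0 : 0 < absv (T e1 a) :> R by rewrite lt_neqAle absv_ge0 eq_sym absv_eq0 Ta.
have /asboolP/(_ _ Ta0) := valP (T e1); apply: sub_finite_set => _ [c _ <-] /=.
by rewrite center_class_function.
Qed.

Lemma sum_conjugates_central (a : G) (s : seq G) : uniq s ->
  conjugates a = [set` s] -> commutant U (\sum_(b <- s) right_regular G K b).
Proof.
move=> us hs _ [g _ <-]; rewrite mulr_suml mulr_sumr.
have sJ c b : b \in s -> (c^-1 * b * c)%g \in s.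
  move=> sb; have [d _ <-] : conjugates a b by rewrite hs.
  suff : conjugates a (c^-1 * (d^-1 * a * d) * c)%g by rewrite hs.
  by exists (d * c)%g => //; rewrite invgM !mulgA.
(* Conjugation by [g] permutes the class; reindexing by it turns each product with [g] on the right
   into one with [g] on the left. *)
have sJs : perm_eq s [seq (g * b * g^-1)%g | b <- s].
  apply: uniq_perm => //.
    by rewrite map_inj_uniq // => b c /mulIg/mulgI.
  move=> b; apply/idP/mapP => [sb|[c sc ->]].
    by exists (g^-1 * b * g)%g; rewrite ?sJ // !mulgA mulgV mul1g mulgK.
  by have := sJ g^-1%g _ sc; rewrite invgK.
rewrite [LHS](perm_big _ sJs) big_map; apply: eq_bigr => b _.
by rewrite -!right_regularM mulgVK.
Qed.

(** The sum over a finite class of [a] is central. Applied to [delta 1] it has coordinate 1 at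
    [a^-1], where a scalar operator gives 0 because [a] is not 1. *)
Lemma scalar_center_icc :
  (forall T, commutant U T -> commutant V T -> exists k : K, k%:A = T) ->
  forall a : G, a <> 1%g -> infinite_set (conjugates a).
Proof.
move=> scal a a1 /finite_seqP[s0 hs0]; pose s := undup s0.
have us : uniq s := undup_uniq s0.
have hs : conjugates a = [set` s].
  by rewrite hs0; apply/seteqP; split=> b /=; rewrite mem_undup.
have sa : a \in s.
  suff : conjugates a a by rewrite hs.
  by exists 1%g => //; rewrite invg1 mul1g mulg1.
have [||k /bounded_opP/(_ e1)/c0P/(_ a^-1%g)] :=
  scal (\sum_(b <- s) right_regular G K b).
- exact: sum_conjugates_central hs.
- move=> S VS; rewrite mulr_suml mulr_sumr; apply: eq_bigr => b _.
  by apply: right_sub_commutant_left => //; exists b.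
rewrite bounded_opZE bounded_op1E c0ZE deltaE bounded_op_sumE c0_sumE.
rewrite (_ : (_ == 1%g) = false) ?mulr0; last first.
  by apply/negbTE; rewrite invg_eq1; exact/eqP.
rewrite (bigD1_seq a) //= mulVg eqxx big1 ?addr0 => [/eqP|b /negPf ba].
  by rewrite eq_sym oner_eq0.
by case: eqP => // /(canRL (mulVKg a)); rewrite mulg1 => /eqP; rewrite ba.
Qed.

Lemma is_factor_icc : is_factor (commutant V) <->
  forall a : G, a <> 1%g -> infinite_set (conjugates a).
Proof.
(* This makes the center the set of operators commuting with both families of translations. *)
have VU : commutant (commutant V) = commutant U.
  by rewrite -right_strong_closed_span commutant_strong_closed_span.
rewrite /is_factor VU; split=> [h|icc].
  apply: scalar_center_icc => T UT VT.
  by have : (commutant V `&` commutant U) T by []; rewrite h => -[k _ <-]; exists k.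
apply/seteqP; split=> [T [VT UT]|_ [k _ <-]].
  by rewrite [T](icc_center_scalar icc) //; exists (T e1 1%g : K).
by split=> S _; rewrite mulr_algl mulr_algr.
Qed.

End RegularClosures.

(** * The reduction and the group algebra over the residue field *)

Section ReductionIso.
Local Open Scope quotient_scope.
Context (R : realType) (G : groupType) (K : completeNonArchFieldType R).
Local Notation L := (bounded_op G K).
Local Notation O := (integers K).
Local Notation k := (residue_field K).
Local Notation V := (range (left_regular G K)).
Local Notation e1 := (delta K (1%g : G)).
Local Notation M1 := (unit_ball (right_vn_algebra G K)).
Local Notation Mred := (reduction (right_vn_algebra G K)).
Implicit Types S T : M1.

Lemma residue_eq0 (c : O) : (\pi_k c == 0) = (absv (val c) < 1).
Proof.
rewrite (_ : 0 = \pi_k 0); last by rewrite [LHS]piE.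
by rewrite -Quotient.idealrBE subr0.
Qed.

Lemma residue_eq (c d : O) : (\pi_k c == \pi_k d) = (absv (val c - val d) < 1).
Proof. by rewrite -Quotient.idealrBE. Qed.

Lemma right_vnP (T : L) : (T \in right_vn_algebra G K) <-> commutant V T.
Proof. by rewrite inE /right_vn right_strong_closed_span. Qed.

Lemma unit_ball_commutant T : commutant V (val T).
Proof. by apply/right_vnP; have /andP[] := valP T. Qed.

Fact coef_subproof T a : (val T e1 a^-1%g : K) \in @integers_pred R K.
Proof.
have /andP[_ T1] := valP T; apply: le_trans T1.
rewrite op_norm_right_vn; last exact: unit_ball_commutant.
exact: absv_le_c0_norm.
Qed.
(* [a^-1]: [right_regular g] sends [delta 1] to [delta g^-1]. *)
Definition coef T a : O := Integer (coef_subproof T a).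

(** A nonzero residue means a coefficient of absolute value at least 1, and a family tending to 0
    has only finitely many of these. *)
Fact reduction_coef_subproof T :
  (fun a => \pi_k (coef T a) : k^o) \in @finitely_supported k G.
Proof.
apply/asboolP; have /asboolP/(_ _ ltr01) fin := valP (val T e1).
apply: (sub_finite_set _ (finite_image (fun b : G => b^-1%g) fin)) => a /=.
rewrite residue_eq0 -leNgt => Ta; exists a^-1%g => //; exact: invgK.
Qed.
Definition reduction_coef T : group_algebra k G :=
  GroupAlgebra (reduction_coef_subproof T).

Lemma reduction_coefB S T : reduction_coef (S - T) = reduction_coef S - reduction_coef T.
Proof.
apply/group_algebraP => a; transitivity (\pi_k (coef S a - coef T a)).
  by congr (\pi_k _); exact: val_inj.
by rewrite [RHS]piE.
Qed.

(** All residues vanish when every coefficient is below 1 in absolute value; by [c0_norm_lt] the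
    norm of [T (delta 1)], which is that of [T], is then below 1 as well. *)
Lemma reduction_coef_eq0 T : (reduction_coef T == 0) = (T \in @open_unit_ball R G K _).
Proof.
rewrite unfold_in op_norm_right_vn; last exact: unit_ball_commutant.
apply/eqP/idP => [/group_algebraP T0|T1].
  apply: c0_norm_lt => // a; have /eqP := T0 a^-1%g.
  by rewrite residue_eq0 /= invgK.
apply/group_algebraP => a; apply/eqP; rewrite residue_eq0.
exact: le_lt_trans (absv_le_c0_norm _ _) T1.
Qed.

Definition reduction_iso (x : Mred) : group_algebra k G := reduction_coef (repr x).

(** The map does not depend on the representative, since two of them differ by an element of norm
    below 1, which has zero residues. *)
Lemma reduction_iso_pi T : reduction_iso (\pi_Mred T) = reduction_coef T.
Proof.
apply/esym/eqP; rewrite -subr_eq0 -reduction_coefB reduction_coef_eq0.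
exact: repr_reduction.
Qed.

Lemma reduction_isoB : zmod_morphism reduction_iso.
Proof.
elim/quotW=> S; elim/quotW=> T.
rewrite (_ : _ - _ = \pi_Mred (S - T)); last by rewrite [LHS]piE.
by rewrite !reduction_iso_pi reduction_coefB.
Qed.

Lemma reduction_isoZ : scalable reduction_iso.
Proof.
elim/quotW=> c; elim/quotW=> T.
rewrite [_ *: _](reduction_piZ c T) !reduction_iso_pi.
apply/group_algebraP => a; rewrite group_algebraZE /= residue_piM.
by congr (\pi_k _); exact: val_inj.
Qed.

Lemma sum_right_regular (s : seq G) (c : G -> K) a : uniq s ->
  (\sum_(g <- s) c g *: right_regular G K g : L) e1 a^-1%g = (a \in s)%:R * c a.
Proof.
move=> us; rewrite bounded_op_sumE.
rewrite (_ : \sum_(g <- s) _ =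
  \sum_(h <- [seq g^-1%g | g <- s]) c h^-1%g *: delta K h); last first.
  rewrite big_map; apply: eq_bigr => g _.
  by rewrite bounded_opZE right_regular_delta mul1g invgK.
by rewrite sum_delta ?map_inj_uniq ?mem_map ?invgK //; exact: invg_inj.
Qed.

Lemma sum_right_regular_commutant (s : seq G) (c : G -> K) :
  commutant V (\sum_(g <- s) c g *: right_regular G K g).
Proof.
apply: (linear_span_commutant (@right_sub_commutant_left R G K)).
exists [seq (c g, right_regular G K g) | g <- s]; last by rewrite big_map.
by move=> _ /mapP[g _ ->]; exists g.
Qed.

Lemma residue_sum (I : Type) (s : seq I) (F : I -> O) :
  \pi_k (\sum_(i <- s) F i) = \sum_(i <- s) \pi_k (F i).
Proof.
apply: (big_morph (\pi_k : O -> k)) => [c d|]; first by rewrite residue_piD.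
by rewrite [RHS]piE.
Qed.

(* Modulo operators of norm < 1, [S] is the finite combination of right
   translations supported on the residually nonzero coefficients. *)
Lemma reduction_coefM S T : reduction_coef (S * T) = reduction_coef S * reduction_coef T.
Proof.
have [s us hs] := group_algebra_supp (reduction_coef S).
apply/group_algebraP => b; rewrite [RHS](convolutionE _ _ us hs) /=.
under eq_bigr do rewrite residue_piM.
rewrite -residue_sum; apply/eqP; rewrite residue_eq.
pose Q : L := \sum_(g <- s) val (coef S g) *: right_regular G K g.
have SQ : op_norm (val S - Q) < 1.
  rewrite op_norm_right_vn => [|y Vy]; last first.
    by rewrite mulrBl mulrBr unit_ball_commutant // sum_right_regular_commutant.
  apply: c0_norm_lt => // a; rewrite -[a]invgK bounded_opDE bounded_opNE c0DE c0NE.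
  rewrite sum_right_regular //.
  have [_|sa] := boolP (a^-1%g \in s); first by rewrite mul1r subrr absv0.
  rewrite mul0r subr0; have := contra (hs a^-1%g) sa.
  by rewrite negbK residue_eq0.
(* Convolving with the coefficients of [Q] amounts to applying [Q] to [T (delta 1)], so the
   discrepancy is a coordinate of [(S - Q) (T (delta 1))], of norm at most [op_norm (S - Q)]. *)
rewrite (_ : _ - _ = ((val S - Q) (val T e1) : c0 G K) b^-1%g); last first.
  rewrite bounded_opDE bounded_opNE c0DE c0NE; congr (_ - _).
  rewrite raddf_sum bounded_op_sumE c0_sumE; apply: eq_bigr => g _.
  by rewrite bounded_opZE c0ZE right_regularE /= invgM invgK.
apply: (le_lt_trans (absv_le_c0_norm _ _)); apply: le_lt_trans SQ.
apply: (le_trans (le_op_norm _ _)); rewrite ler_piMr ?op_norm_ge0 //.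
rewrite -op_norm_right_vn; last exact: unit_ball_commutant.
by have /andP[] := valP T.
Qed.

Lemma reduction_isoM : monoid_morphism reduction_iso.
Proof.
split; last first.
  elim/quotW=> S; elim/quotW=> T.
  by rewrite [_ * _](reduction_piM S T) !reduction_iso_pi reduction_coefM.
have -> : 1 = \pi_Mred 1 :> Mred by [].
rewrite reduction_iso_pi; apply/group_algebraP => a /=.
rewrite (_ : coef 1 a = (a == 1%g)%:R).
  by case: eqP => _; rewrite ?residue_pi1 // [RHS]piE.
apply: val_inj; transitivity (delta K 1%g a^-1%g); first by [].
by rewrite deltaE invg_eq1; case: eqP.
Qed.

HB.instance Definition _ := GRing.isZmodMorphism.Build Mred (group_algebra k G)
  reduction_iso reduction_isoB.
HB.instance Definition _ := GRing.isMonoidMorphism.Build Mred (group_algebra k G)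
  reduction_iso reduction_isoM.
HB.instance Definition _ := GRing.isScalable.Build k Mred (group_algebra k G) *:%R
  reduction_iso reduction_isoZ.

Lemma reduction_iso_inj : injective reduction_iso.
Proof.
elim/quotW=> S; elim/quotW=> T; rewrite !reduction_iso_pi => ST.
by apply/eqP; rewrite reduction_eq -reduction_coef_eq0 reduction_coefB ST subrr.
Qed.

(** Lift the finitely many nonzero values of [f] to integers of [K] and combine right translations
    with these coefficients; the norm is at most 1 because it is read off from the coefficients. *)
Lemma reduction_iso_surj f : exists x, reduction_iso x = f.
Proof.
have [s us hs] := group_algebra_supp f.
pose c g : O := repr (f g).
pose T : L := \sum_(g <- s) val (c g) *: right_regular G K g.
have TV : commutant V T by exact: sum_right_regular_commutant.
have T1 : T \in unit_ball_pred (right_vn_algebra G K).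
  apply/andP; split; first exact/right_vnP.
  rewrite op_norm_right_vn //; apply: c0_norm_le => a.
  rewrite -[a]invgK sum_right_regular //; case: (_ \in s).
    by rewrite mul1r; exact: (valP (c a^-1%g)).
  by rewrite mul0r absv0.
exists (\pi_Mred (UnitBall T1)); rewrite reduction_iso_pi.
apply/group_algebraP => a /=.
rewrite (_ : coef _ a = (a \in s)%:R * c a); last first.
  by apply: val_inj; rewrite /= sum_right_regular //; case: (a \in s).
have [_|sa] := boolP (a \in s); first by rewrite mul1r reprK.
rewrite mul0r; have := contra (hs a) sa; rewrite negbK => /eqP ->.
by rewrite [RHS]piE.
Qed.

Lemma reduction_iso_bij : bijective reduction_iso.
Proof.
pose g f := projT1 (cid (reduction_iso_surj f)).
have gK : cancel g reduction_iso by move=> f; rewrite /g; case: cid.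
by exists g => // x; apply: reduction_iso_inj; rewrite gK.
Qed.

End ReductionIso.

Theorem mainTheorem1 (R : realType) (K : completeNonArchFieldType R)
    (G : groupType) :
  let U := range (right_regular G K) in
  let V := range (left_regular G K) in
  let M := strong_closed_span U in
  let N := strong_closed_span V in
  [/\ [/\ M = uniform_closed_span U,
          M = commutant V,
          N = commutant U,
          M = commutant (commutant U) /\ M = commutant (commutant M)
        & N = commutant (commutant V) /\ N = commutant (commutant N)],
      exists f : {lrmorphism reduction (right_vn_algebra G K) ->
                    group_algebra (residue_field K) G}, bijective f
    & is_factor M <->
        forall a : G, a <> 1%g -> infinite_set (conjugates a)].
Proof.
move=> U V M N.
have MV : M = commutant V := right_strong_closed_span G K.
have NU : N = commutant U := left_strong_closed_span G K.
(* Strong closure leaves commutants unchanged, so the commutant of [commutant U = N] is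
   [commutant V = M]; the bicommutant statements follow, and symmetrically for [N]. *)
have M' : commutant M = commutant U := commutant_strong_closed_span U.
have N' : commutant N = commutant V := commutant_strong_closed_span V.
split; last by rewrite MV; exact: is_factor_icc.
  split=> //; first by rewrite MV -right_uniform_closed_span.
    by rewrite M' -NU N'.
  by rewrite N' -MV M'.
by exists (@reduction_iso R G K); exact: reduction_iso_bij.
Qed.
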